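(* Let $n\ge 1$. The braid group $B_n$ admits the following (redundant) group presentation: generators $\sigma_1,\dots,\sigma_{n-1}$ and $A_{ij}$ for $1\le i<j\le n$ (where the $\sigma_i$ correspond to the standard braid generators and the $A_{ij}$ to the right pure braid generators), with defining relations $$\begin{array}{rrcll} \Sigma_1) & \sigma_i\sigma_j & = & \sigma_j\sigma_i & |i-j|>1\\ \Sigma_2) & \sigma_i\sigma_{i+1}\sigma_i & = & \sigma_{i+1}\sigma_i\sigma_{i+1} & 1\le i\le n-2\\ \Sigma_3) & \sigma_i^2 & = & A_{i,i+1} & 1\le i\le n-1\\ P_1) & A_{ij}A_{rs} & = & A_{rs}A_{ij} & i<j<r<s,\ \text{ and } i<r<s<j\\ P_2) & A_{ir}A_{is}A_{rs} & = & A_{is}A_{rs}A_{ir} & i<r<s\\ P_3) & A_{rs}A_{ir}A_{is} & = & A_{ir}A_{is}A_{rs} & i<r<s\\ P_4) & (A_{rj}A_{rs}A_{rj}^{-1})A_{ij} & = & A_{ij}(A_{rj}A_{rs}A_{rj}^{-1}) & i<r<j<s\\ M_1) & \sigma_{i-1}^{-1}A_{ij}\sigma_{i-1} & = & A_{i-1,j} & 1<i<j\le n\\ M_2) & \sigma_i^{-1}A_{ij}\sigma_i & = & A_{i,i+1}^{-1}A_{i+1,j}A_{i,i+1} & 1<i+1<j\le n\\ M_3) & \sigma_{j-1}^{-1}A_{ij}\sigma_{j-1} & = & A_{i,j-1} & 1\le i<j-1,\ j\le n\\ M_4) & \sigma_j^{-1}A_{ij}\sigma_j & = & A_{ij}A_{i,j+1}A_{ij}^{-1}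 & 1\le i<j\le n-1\\ M_5) & \sigma_i^{-1}A_{rs}\sigma_i & = & A_{rs} & i<r-1,\ \text{ or } r<i<s-1,\ \text{ or } s<i \end{array}$$ where all indices of the $A$'s range in $\{1,\dots,n\}$ and all indices of the $\sigma$'s in $\{1,\dots,n-1\}$.
   Context: $B_n$ is the Artin braid group with generators $\sigma_1,\dots,\sigma_{n-1}$ and relations $\sigma_i\sigma_j=\sigma_j\sigma_i$ for $|i-j|>1$ and $\sigma_i\sigma_{i+1}\sigma_i=\sigma_{i+1}\sigma_i\sigma_{i+1}$ for $1\le i\le n-2$. The right pure braid generators (right loop generators) are the elements of $B_n$ $$A_{ij}=\sigma_i^{-1}\sigma_{i+1}^{-1}\cdots\sigma_{j-2}^{-1}\,\sigma_{j-1}^2\,\sigma_{j-2}\cdots\sigma_{i+1}\sigma_i,\qquad 1\le i<j\le n.$$ *)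

(* Defs.v *)
From HB Require Import structures.
From mathcomp Require Import all_boot.
From mathcomp Require Import boolp.

Set Implicit Arguments.
Unset Strict Implicit.
Unset Printing Implicit Defensive.

Local Open Scope quotient_scope.
Local Open Scope group_scope.

Section FreeGroup.
Variable X : choiceType.

(* (x, false) stands for the generator x and (x, true) for its inverse. *)
Definition gword := seq (X * bool).

Definition letter_inv (a : X * bool) := (a.1, ~~ a.2).
Definition gword_inv (w : gword) : gword := rev (map letter_inv w).

Inductive free_cong : gword -> gword -> Prop :=
| free_refl w : free_cong w w
| free_sym w1 w2 : free_cong w1 w2 -> free_cong w2 w1
| free_trans w1 w2 w3 : free_cong w1 w2 -> free_cong w2 w3 -> free_cong w1 w3
| free_cancel u a v : free_cong (u ++ a :: letter_inv a :: v) (u ++ v).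

Definition free_eqb : rel gword := fun w1 w2 => `[< free_cong w1 w2 >].

Lemma free_eqb_refl : reflexive free_eqb.
Proof. by move=> w; apply/asboolP; exact: free_refl. Qed.

Lemma free_eqb_sym : symmetric free_eqb.
Proof.
by move=> w1 w2; apply/idP/idP => /asboolP h; apply/asboolP; exact: free_sym.
Qed.

Lemma free_eqb_trans : transitive free_eqb.
Proof.
by move=> w2 w1 w3 /asboolP h1 /asboolP h2; apply/asboolP; exact: free_trans h2.
Qed.

Canonical free_equiv :=
  EquivRel free_eqb free_eqb_refl free_eqb_sym free_eqb_trans.

Definition free_group := {eq_quot free_equiv}.
HB.instance Definition _ := Choice.on free_group.
HB.instance Definition _ := EqQuotient.on free_group.

Lemma free_piP (w1 w2 : gword) :
  free_cong w1 w2 <-> \pi_free_group w1 = \pi_free_group w2.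
Proof.
by split=> [h|/eqmodP/asboolP//]; apply/eqmodP/asboolP.
Qed.

Lemma free_cong_catl u w1 w2 : free_cong w1 w2 -> free_cong (u ++ w1) (u ++ w2).
Proof.
elim=> {w1 w2} [w|w1 w2 _|w1 w2 w3 _ h1 _ h2|u' a v].
- exact: free_refl.
- exact: free_sym.
- exact: free_trans h2.
- by rewrite !catA; exact: free_cancel.
Qed.

Lemma free_cong_catr u w1 w2 : free_cong w1 w2 -> free_cong (w1 ++ u) (w2 ++ u).
Proof.
elim=> {w1 w2} [w|w1 w2 _|w1 w2 w3 _ h1 _ h2|u' a v].
- exact: free_refl.
- exact: free_sym.
- exact: free_trans h2.
- by rewrite -!catA; exact: free_cancel.
Qed.

Lemma letter_invK : involutive letter_inv.
Proof. by case=> x b; rewrite /letter_inv /= negbK. Qed.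

Lemma gword_inv_cat w1 w2 : gword_inv (w1 ++ w2) = gword_inv w2 ++ gword_inv w1.
Proof. by rewrite /gword_inv map_cat rev_cat. Qed.

Lemma gword_invK : involutive gword_inv.
Proof.
by move=> w; rewrite /gword_inv map_rev revK mapK //; exact: letter_invK.
Qed.

Lemma free_cong_inv w1 w2 :
  free_cong w1 w2 -> free_cong (gword_inv w1) (gword_inv w2).
Proof.
elim=> {w1 w2} [w|w1 w2 _|w1 w2 w3 _ h1 _ h2|u a v].
- exact: free_refl.
- exact: free_sym.
- exact: free_trans h2.
- rewrite -cat1s -(cat1s (letter_inv a)) !gword_inv_cat -!catA.
  have -> : gword_inv [:: letter_inv a] = [:: a].
    by rewrite /gword_inv /= letter_invK.
  exact: free_cancel.
Qed.

Lemma free_cong_invr w : free_cong (w ++ gword_inv w) [::].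
Proof.
elim: w => [|a w ih]; first exact: free_refl.
rewrite -[a :: w]cat1s gword_inv_cat -!catA.
apply: free_trans (free_cancel [::] a [::]).
have := free_cong_catl [:: a] (free_cong_catr (gword_inv [:: a]) ih).
by rewrite -catA.
Qed.

Definition free_one : free_group := \pi_free_group [::].
Definition free_mul (x y : free_group) : free_group :=
  \pi_free_group (repr x ++ repr y).
Definition free_inv (x : free_group) : free_group :=
  \pi_free_group (gword_inv (repr x)).

Lemma free_mul_pi w1 w2 :
  free_mul (\pi_free_group w1) (\pi_free_group w2) = \pi_free_group (w1 ++ w2).
Proof.
apply/free_piP; apply: (@free_trans _ (w1 ++ repr (\pi_free_group w2))).
  by apply/free_cong_catr/free_piP; rewrite reprK.
by apply/free_cong_catl/free_piP; rewrite reprK.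
Qed.

Lemma free_inv_pi w :
  free_inv (\pi_free_group w) = \pi_free_group (gword_inv w).
Proof. by apply/free_piP/free_cong_inv/free_piP; rewrite reprK. Qed.

Lemma free_mulA : associative free_mul.
Proof.
move=> x y z; elim/quotW: x => x; elim/quotW: y => y; elim/quotW: z => z.
by rewrite (free_mul_pi y z) (free_mul_pi x y) (free_mul_pi x (y ++ z))
  (free_mul_pi (x ++ y) z) catA.
Qed.

Lemma free_mul1 : left_id free_one free_mul.
Proof. by move=> x; elim/quotW: x => x; rewrite free_mul_pi. Qed.

Lemma free_mulr1 : right_id free_one free_mul.
Proof. by move=> x; elim/quotW: x => x; rewrite free_mul_pi cats0. Qed.

Lemma free_mulV : left_inverse free_one free_inv free_mul.
Proof.
move=> x; elim/quotW: x => x; rewrite free_inv_pi free_mul_pi; apply/free_piP.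
by have := free_cong_invr (gword_inv x); rewrite gword_invK.
Qed.

Lemma free_mulrV : right_inverse free_one free_inv free_mul.
Proof.
move=> x; elim/quotW: x => x; rewrite free_inv_pi free_mul_pi; apply/free_piP.
exact: free_cong_invr.
Qed.

HB.instance Definition _ := isGroup.Build free_group
  free_mulA free_mul1 free_mulr1 free_mulV free_mulrV.

Definition free_gen (x : X) : free_group := \pi_free_group [:: (x, false)].

End FreeGroup.

Section QuotientByRelations.
Variables (G : groupType) (R : G -> G -> Prop).

(* The least congruence containing R; compatibility with inverses follows. *)
Inductive rel_cong : G -> G -> Prop :=
| cong_rel x y : R x y -> rel_cong x y
| cong_refl x : rel_cong x x
| cong_sym x y : rel_cong x y -> rel_cong y x
| cong_trans x y z : rel_cong x y -> rel_cong y z -> rel_cong x z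
| cong_mul x x' y y' :
    rel_cong x x' -> rel_cong y y' -> rel_cong (x * y) (x' * y').

Definition rel_eqb : rel G := fun x y => `[< rel_cong x y >].

Lemma rel_eqb_refl : reflexive rel_eqb.
Proof. by move=> x; apply/asboolP; exact: cong_refl. Qed.

Lemma rel_eqb_sym : symmetric rel_eqb.
Proof.
by move=> x y; apply/idP/idP => /asboolP h; apply/asboolP; exact: cong_sym.
Qed.

Lemma rel_eqb_trans : transitive rel_eqb.
Proof.
by move=> y x z /asboolP h1 /asboolP h2; apply/asboolP; exact: cong_trans h2.
Qed.

Canonical rel_equiv := EquivRel rel_eqb rel_eqb_refl rel_eqb_sym rel_eqb_trans.

Definition rel_quot := {eq_quot rel_equiv}.
HB.instance Definition _ := Choice.on rel_quot.
HB.instance Definition _ := EqQuotient.on rel_quot.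

Lemma rel_piP (x y : G) : rel_cong x y <-> \pi_rel_quot x = \pi_rel_quot y.
Proof. by split=> [h|/eqmodP/asboolP//]; apply/eqmodP/asboolP. Qed.

Lemma rel_cong_inv x y : rel_cong x y -> rel_cong x^-1 y^-1.
Proof.
move=> h; have := cong_mul (cong_mul (cong_refl x^-1) (cong_sym h))
  (cong_refl y^-1).
by rewrite mulVg mul1g -mulgA mulgV mulg1.
Qed.

Definition quot_one : rel_quot := \pi_rel_quot 1.
Definition quot_mul (x y : rel_quot) : rel_quot :=
  \pi_rel_quot (repr x * repr y).
Definition quot_inv (x : rel_quot) : rel_quot := \pi_rel_quot (repr x)^-1.

Lemma quot_mul_pi x y :
  quot_mul (\pi_rel_quot x) (\pi_rel_quot y) = \pi_rel_quot (x * y).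
Proof. by apply/rel_piP/cong_mul; apply/rel_piP; rewrite reprK. Qed.

Lemma quot_inv_pi x : quot_inv (\pi_rel_quot x) = \pi_rel_quot x^-1.
Proof. by apply/rel_piP/rel_cong_inv/rel_piP; rewrite reprK. Qed.

Lemma quot_mulA : associative quot_mul.
Proof.
move=> x y z; elim/quotW: x => x; elim/quotW: y => y; elim/quotW: z => z.
by rewrite (quot_mul_pi y z) (quot_mul_pi x y) (quot_mul_pi x (y * z))
  (quot_mul_pi (x * y) z) mulgA.
Qed.

Lemma quot_mul1 : left_id quot_one quot_mul.
Proof. by move=> x; elim/quotW: x => x; rewrite quot_mul_pi mul1g. Qed.

Lemma quot_mulr1 : right_id quot_one quot_mul.
Proof. by move=> x; elim/quotW: x => x; rewrite quot_mul_pi mulg1. Qed.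

Lemma quot_mulV : left_inverse quot_one quot_inv quot_mul.
Proof.
by move=> x; elim/quotW: x => x; rewrite quot_inv_pi quot_mul_pi mulVg. Qed.

Lemma quot_mulrV : right_inverse quot_one quot_inv quot_mul.
Proof.
by move=> x; elim/quotW: x => x; rewrite quot_inv_pi quot_mul_pi mulgV. Qed.

HB.instance Definition _ := isGroup.Build rel_quot
  quot_mulA quot_mul1 quot_mulr1 quot_mulV quot_mulrV.

End QuotientByRelations.

Definition presented (X : choiceType)
    (R : free_group X -> free_group X -> Prop) : groupType := rel_quot R.

Definition pres_gen (X : choiceType) (R : free_group X -> free_group X -> Prop)
    (x : X) : presented R := \pi_(rel_quot R) (free_gen x).

(* G has the presentation < X | R >, the generator x corresponding to g x. *)
Definition has_presentation (G : groupType) (X : choiceType)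
    (R : free_group X -> free_group X -> Prop) (g : X -> G) : Prop :=
  exists f : {multiplicative presented R -> G},
    bijective f /\ forall x, f (pres_gen R x) = g x.

Arguments has_presentation G {X} R g.

Definition sigma_index (n : nat) : choiceType := {i : nat | (0 < i < n)%N}.

Definition pure_index (n : nat) : choiceType :=
  {p : nat * nat | (0 < p.1 < p.2)%N && (p.2 <= n)%N}.

(* The relations below are written over families indexed by nat or nat * nat, *)
(* so that index arithmetic is that of nat. The default value 1 never occurs  *)
(* in them: their side conditions keep all indices in the valid range.        *)
Definition ext (T : Type) (P : pred T) (G : groupType) (g : {x : T | P x} -> G)
    (x : T) : G :=
  if insub x is Some u then g u else 1.

Section Relations.
Variables (G : groupType) (n : nat).

Inductive artin_rel (s : nat -> G) : G -> G -> Prop :=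
| Sigma1 i j : (0 < i < n)%N -> (0 < j < n)%N ->
    (i.+1 < j)%N || (j.+1 < i)%N ->
    artin_rel s (s i * s j) (s j * s i)
| Sigma2 i : (0 < i)%N -> (i.+1 < n)%N ->
    artin_rel s (s i * s i.+1 * s i) (s i.+1 * s i * s i.+1).

Inductive redundant_rel (s : nat -> G) (A : nat -> nat -> G) :
    G -> G -> Prop :=
| Sigma12 x y : artin_rel s x y -> redundant_rel s A x y
| Sigma3 i : (0 < i < n)%N ->
    redundant_rel s A (s i ^+ 2) (A i i.+1)
| P1_disjoint i j r t : (0 < i < j)%N -> (j < r < t)%N -> (t <= n)%N ->
    redundant_rel s A (A i j * A r t) (A r t * A i j)
| P1_nested i j r t : (0 < i < r)%N -> (r < t < j)%N -> (j <= n)%N ->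
    redundant_rel s A (A i j * A r t) (A r t * A i j)
| P2 i r t : (0 < i < r)%N -> (r < t <= n)%N ->
    redundant_rel s A (A i r * A i t * A r t) (A i t * A r t * A i r)
| P3 i r t : (0 < i < r)%N -> (r < t <= n)%N ->
    redundant_rel s A (A r t * A i r * A i t) (A i r * A i t * A r t)
| P4 i r j t : (0 < i < r)%N -> (r < j < t)%N -> (t <= n)%N ->
    redundant_rel s A ((A r j * A r t * (A r j)^-1) * A i j)
                      (A i j * (A r j * A r t * (A r j)^-1))
| M1 i j : (1 < i < j)%N -> (j <= n)%N ->
    redundant_rel s A ((s i.-1)^-1 * A i j * s i.-1) (A i.-1 j)
| M2 i j : (1 < i.+1 < j)%N -> (j <= n)%N ->
    redundant_rel s A ((s i)^-1 * A i j * s i)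
                      ((A i i.+1)^-1 * A i.+1 j * A i i.+1)
| M3 i j : (0 < i < j.-1)%N -> (j <= n)%N ->
    redundant_rel s A ((s j.-1)^-1 * A i j * s j.-1) (A i j.-1)
| M4 i j : (0 < i < j)%N -> (j < n)%N ->
    redundant_rel s A ((s j)^-1 * A i j * s j)
                      (A i j * A i j.+1 * (A i j)^-1)
| M5 i r t : (0 < i < n)%N -> (0 < r < t)%N -> (t <= n)%N ->
    [|| (i < r.-1)%N, (r < i < t.-1)%N | (t < i)%N] ->
    redundant_rel s A ((s i)^-1 * A r t * s i) (A r t).

End Relations.

Definition braid_rel (n : nat) :=
  artin_rel n (ext (@free_gen (sigma_index n))).

Definition braid_group (n : nat) : groupType := presented (@braid_rel n).

Definition sigma (n : nat) (i : sigma_index n) : braid_group n :=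
  pres_gen (@braid_rel n) i.

Definition pure_gen (n i j : nat) : braid_group n :=
  let s := ext (@sigma n) in
  (\prod_(i <= k < j.-1) (s k)^-1) * s j.-1 ^+ 2 *
  (\prod_(k <- rev (index_iota i j.-1)) s k).

Definition redundant_gen (n : nat) : choiceType :=
  (sigma_index n + pure_index n)%type.

Definition redundant_braid_rel (n : nat) :=
  redundant_rel n
    (ext (fun i : sigma_index n => free_gen (inl i : redundant_gen n)))
    (fun i j =>
       ext (fun p : pure_index n => free_gen (inr p : redundant_gen n)) (i, j)).

Definition redundant_gen_val (n : nat) (x : redundant_gen n) : braid_group n :=
  match x with
  | inl i => sigma i
  | inr p => pure_gen n (val p).1 (val p).2
  end.

(* Main.v *)
(** In terms of conjugation, [A_ij] is determined by [A_{i,i+1} = sigma_i^2] and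
    [A_ij = A_{i+1,j} ^ sigma_i], which are instances of [Sigma_3] and [M_1];
    so the redundant presentation is the Artin presentation with the [A_ij]
    adjoined by their definitions, once all its relations are shown to follow
    from those two and the Artin relations.
    First [A_ij] commutes with every [sigma_k], [k <> i-1, i, j-1, j] ([M_5]),
    which gives both cases of [P_1]. Then
    [A_{i,j+1} = A_ij ^ sigma_j^-1] ([M_3]), by decreasing induction on [i].
    Conjugating by such [sigma]'s reduces [P_2] and [P_3] to adjacent strands,
    where with [a = sigma_i], [b = sigma_{i+1}] they say that [a] commutes with
    [b a a b] and [b] with [a b b a]; likewise [P_4] reduces to [s = j+1], where
    by [M_4] it is a [sigma_j]-conjugate of a nested [P_1]. *)
Require Import Defs.
From HB Require Import structures.
From mathcomp Require Import all_boot.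
From mathcomp Require Import zify.

Set Implicit Arguments.
Unset Strict Implicit.
Unset Printing Implicit Defensive.

Local Open Scope group_scope.

(** * Commutation and conjugation in a group *)

Section Commutation.
Variable G : groupType.
Implicit Types x y z : G.

Lemma conjg_commute x y : commute x y -> x ^ y = x.
Proof. by move=> cxy; rewrite conjgE cxy mulKg. Qed.

Lemma commuteJ x y z : commute x y -> commute x z -> commute x (y ^ z).
Proof.
by move=> cxy cxz; do 2?[apply: commuteM] => //; exact: commuteV.
Qed.

Lemma commute_conjg x y z : commute x y -> commute (x ^ z) (y ^ z).
Proof. by move=> cxy; rewrite /commute -!conjMg cxy. Qed.

Lemma mulgVE x y : x * y * x^-1 = y ^ x^-1.
Proof. by rewrite conjgE invgK mulgA. Qed.

End Commutation.

(** * Identities on three adjacent strands *)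

(** With [a = s i] and [b = s i.+1], the factors are $A_{i,i+1}$ and $A_{i,i+2}$, whose product
    occurs in $P_3$. *)
Lemma sqr_mul_conj (G : groupType) (a b : G) :
  a ^+ 2 * b ^+ 2 ^ a = a * b * b * a.
Proof. by rewrite !expgS !expg0 !mulg1 -mulgA -conjgC !mulgA. Qed.

Lemma braid_conjV (G : groupType) (a b : G) :
  a * b * a = b * a * b -> b ^ a = a ^ b^-1.
Proof.
move=> aba; apply: (@mulgI _ a); apply: (@mulIg _ b).
by rewrite conjgE mulVKg -aba -mulgVE !mulgA mulgVK.
Qed.

Section BraidRelation.
Variables (G : groupType) (a b : G).
Hypothesis aba : a * b * a = b * a * b.

Lemma braid_conjM : a ^ (b * a) = b.
Proof. by rewrite conjgM (braid_conjV (esym aba)) conjgKV. Qed.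

Lemma braid_commute : commute a (b * a * a * b).
Proof.
by rewrite /commute !mulgA aba -!mulgA; congr (_ * (_ * _)); rewrite !mulgA.
Qed.

(** The factors are $A_{i,i+2}$ and $A_{i+1,i+2}$, whose product occurs in $P_2$. *)
Lemma braid_conj_sqr : b ^+ 2 ^ a * b ^+ 2 = b * a * a * b.
Proof.
apply: (@mulgI _ a); rewrite mulgA -conjgC !expgS expg0 !mulg1.
rewrite !mulgA aba -!mulgA; congr (_ * _); rewrite !mulgA.
by rewrite -aba.
Qed.

End BraidRelation.

(** Since [A_step] obtains [A i j] from [A i.+1 j], facts about these elements descend from a
    largest first index [m]. *)
Lemma nat_down_ind (P : nat -> Prop) (m : nat) :
    P m -> (forall i, 0 < i < m -> P i.+1 -> P i) ->
  forall i, 0 < i <= m -> P i.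
Proof.
move=> Pm Pdown i; move Ek: (m - i)%N => k.
elim: k i Ek => [|k IHk] i Ek lim; first by have -> : i = m by lia.
by apply: Pdown; [lia | apply: IHk; lia].
Qed.

(** * Deriving the redundant relations from the Artin relations, $\Sigma_3$ and $M_1$ *)

Section PureBraidRelations.
Variables (G : groupType) (n : nat) (s : nat -> G) (A : nat -> nat -> G).
Hypothesis s_artin : forall x y, artin_rel n s x y -> x = y.
Hypothesis A_base : forall i, 0 < i < n -> A i i.+1 = s i ^+ 2.
Hypothesis A_step : forall i j, 0 < i -> i.+1 < j <= n ->
  A i j = A i.+1 j ^ s i.

Lemma artin_commute i j : 0 < i < n -> 0 < j < n ->
  (i.+1 < j) || (j.+1 < i) -> commute (s i) (s j).
Proof. by move=> hi hj hij; apply/s_artin/Sigma1. Qed.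

Lemma artin_braid i : 0 < i -> i.+1 < n ->
  s i * s i.+1 * s i = s i.+1 * s i * s i.+1.
Proof. by move=> hi hn; apply/s_artin/Sigma2. Qed.

(** $A_{ij}$ lies in the subgroup generated by $\sigma_i,\dots,\sigma_{j-1}$. *)
Lemma commute_pure x i j : 0 < i < j -> j <= n ->
  (forall k, i <= k < j -> commute x (s k)) -> commute x (A i j).
Proof.
case: j => [|j]; first lia.
move=> hij hj; have {}hij : 0 < i <= j by lia.
have j_gt0 : 0 < j by lia.
move: i hij; apply: nat_down_ind => [|i hi IHi] xs.
  by rewrite A_base; [apply/commuteX/xs; lia | lia].
rewrite A_step; [|lia|lia].
by apply: commuteJ; [apply: IHi => k hk; apply: xs; lia | apply: xs; lia].
Qed.

Lemma commute_pure_far k i j : 0 < k < n -> 0 < i < j -> j <= n ->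
  (k.+1 < i) || (j < k) -> commute (s k) (A i j).
Proof.
move=> hk hij hj kij; apply: commute_pure => // l hl.
by apply: artin_commute; lia.
Qed.

Lemma commute_pure_mid k i j : 0 < i < k -> k.+1 < j -> j <= n ->
  commute (s k) (A i j).
Proof.
case: k => [|k]; first lia.
move=> hik hkj hj; have {}hik : 0 < i <= k by lia.
have k_gt0 : 0 < k by lia.
move: i hik; apply: nat_down_ind => [|i hi IHi].
  rewrite (@A_step k) ?(@A_step k.+1) -?conjgM; try lia.
  (* Both elements are conjugates by [s k.+1 * s k]: of [s k] and of [A k.+2 j], which are far
     apart. *)
  rewrite -[X in commute X](braid_conjM (artin_braid k_gt0 _)); last lia.
  by apply/commute_conjg/commute_pure_far; lia.
rewrite A_step; [|lia|lia].
by apply: commuteJ => //; apply: artin_commute; lia.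
Qed.

(** This is $M_3$ solved for the longer generator. The base case is the braid relation; in the
    inductive step the conjugators $\sigma_i$ and $\sigma_j^{-1}$ commute. *)
Lemma pure_succ i j : 0 < i < j -> j < n -> A i j.+1 = A i j ^ (s j)^-1.
Proof.
case: j => [|j]; first lia.
move=> hij hj; have {}hij : 0 < i <= j by lia.
have j_gt0 : 0 < j by lia.
move: i hij; apply: nat_down_ind => [|i hi IHi].
  rewrite (@A_step j j.+2) ?A_base ?conjXg; try lia.
  by rewrite (braid_conjV (artin_braid j_gt0 hj)).
rewrite (@A_step i j.+2) ?IHi ?(@A_step i j.+1) -?conjgM; try lia.
congr (_ ^ _); apply/esym/commuteV/artin_commute; lia.
Qed.

Lemma pure_conj_last i j : 0 < i < j -> j < n ->
  A i j ^ s j = A i j.+1 ^ (A i j)^-1.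
Proof.
case: j => [|j]; first lia.
move=> hij hj; have {}hij : 0 < i <= j by lia.
have j_gt0 : 0 < j by lia.
move: i hij; apply: nat_down_ind => [|i hi IHi].
  rewrite (@A_step j j.+2) ?A_base ?conjXg -?conjgM; try lia.
  (* As [s j * (s j ^+ 2)^-1] is [(s j)^-1], both sides are squares of equal conjugates. *)
  rewrite (braid_conjV (esym (artin_braid j_gt0 hj))).
  by rewrite expgS expg1 invgM mulVKg.
rewrite (@A_step i j.+1) ?(@A_step i j.+2); try lia.
rewrite -conjVg -conjJg -IHi -!conjgM; congr (_ ^ _).
by apply/artin_commute; lia.
Qed.

Lemma commute_pure_nested i r t j : 0 < i < r -> r < t < j -> j <= n ->
  commute (A i j) (A r t).
Proof.
move=> hir hrtj hj; apply: commute_pure; [lia|lia|move=> k hk].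
by apply/commute_sym/commute_pure_mid; lia.
Qed.

Lemma commute_pure_disjoint i j r t : 0 < i < j -> j < r < t -> t <= n ->
  commute (A i j) (A r t).
Proof.
move=> hij hjrt ht; apply: commute_pure; [lia|lia|move=> k hk].
by apply/commute_sym/commute_pure_far; lia.
Qed.

Lemma commute_pure_triangle i r t : 0 < i < r -> r < t <= n ->
  commute (A i r) (A i t * A r t) /\ commute (A r t) (A i r * A i t).
Proof.
case: r => [|r]; first lia.
move=> hir; have {}hir : 0 < i <= r by lia.
have r_gt0 : 0 < r by lia.
elim: t => // t IHt hrt; case: (eqVneq t r.+1) => [{IHt} t_eq|t_neq]; last first.
  (* Conjugation by [(s t)^-1] fixes [A i r.+1] and raises the last index of the other two
     elements. *)
  have := IHt ltac:(lia); rewrite !(@pure_succ _ t); try lia.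
  have stC : commute (A i r.+1) (s t)^-1.
    by apply/commuteV/commute_sym/commute_pure_far; lia.
  rewrite -[A i r.+1 in X in _ -> X](conjg_commute stC) -!conjMg.
  by case=> h1 h2; split; exact: commute_conjg.
rewrite t_eq in hrt *; move: i hir; apply: nat_down_ind => [|i hi IHi].
  rewrite (@A_step r r.+2) ?A_base; try lia.
  have b := @artin_braid r r_gt0 ltac:(lia).
  rewrite braid_conj_sqr // sqr_mul_conj.
  split; apply/commute_sym/commuteX/commute_sym; exact: braid_commute.
(* Conjugation by [s i] fixes [A r.+1 r.+2] and lowers the first index of the other two elements. *)
have siC : commute (A r.+1 r.+2) (s i).
  by apply/commute_sym/commute_pure_far; lia.
rewrite (@A_step i r.+1) ?(@A_step i r.+2); try lia.
rewrite -[A r.+1 r.+2](conjg_commute siC) -!conjMg.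
by case: IHi => h1 h2; split; exact: commute_conjg.
Qed.

Lemma commute_pure_crossing i r j t : 0 < i < r -> r < j < t -> t <= n ->
  commute (A r t ^ (A r j)^-1) (A i j).
Proof.
move=> hir; elim: t => [|t IHt] hrjt ht; first lia.
case: (eqVneq t j) => [t_eq|t_neq].
  rewrite t_eq in ht *.
  (* The left element is [A r j ^ s j] and the right one is [A i j.+1 ^ s j]; the pairs (r, j) and
     (i, j+1) are nested. *)
  rewrite -pure_conj_last; [|lia|lia].
  rewrite -[A i j](conjgKV (s j)).
  apply: commute_conjg; rewrite -pure_succ; try lia.
  by apply/commute_sym/commute_pure_nested; lia.
(* As t > j, conjugation by [(s t)^-1] only affects [A r t], turning it into [A r t.+1]. *)
have stC k : 0 < k < j -> A k j = A k j ^ (s t)^-1.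
  move=> hk; apply/esym/conjg_commute/commuteV/commute_sym.
  by apply: commute_pure_far; lia.
rewrite (@pure_succ r t); [|lia|lia].
rewrite (stC i); [|lia]; rewrite (stC r); [|lia]; rewrite -conjVg -conjJg.
by apply/commute_conjg/IHt; lia.
Qed.

Lemma redundant_rel_eq x y : redundant_rel n s A x y -> x = y.
Proof.
case=> {x y}.
- exact: s_artin.
- by move=> i hi; rewrite A_base.
- by move=> *; apply: commute_pure_disjoint.
- by move=> *; apply: commute_pure_nested.
- by move=> i r t hir hrt; rewrite -mulgA; case: (commute_pure_triangle hir hrt).
- by move=> i r t hir hrt; rewrite -mulgA; case: (commute_pure_triangle hir hrt).
- by move=> i r j t *; rewrite mulgVE; apply: commute_pure_crossing.
- by case=> // i j hij hj; rewrite -mulgA -conjgE [RHS]A_step //; lia.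
- move=> i j hij hj; rewrite -mulgA -conjgE -[RHS]mulgA -conjgE.
  by rewrite (@A_step i j) ?A_base -?conjgM //; lia.
- move=> i [|j] hij hj; first lia.
  by rewrite -mulgA -conjgE /= pure_succ ?conjgKV //; lia.
- move=> i j hij hj; rewrite -mulgA -conjgE mulgVE; exact: pure_conj_last.
- move=> i r t hi hrt ht h; rewrite -mulgA -conjgE; apply/conjg_commute/commute_sym.
  case/or3P: h => h; try by apply: commute_pure_far; lia.
  by apply: commute_pure_mid; lia.
Qed.

End PureBraidRelations.

(** * Universal properties of free groups and of presentations *)

Section FreeGroupLift.
Variables (X : choiceType) (G : groupType) (g : X -> G).

Definition gword_val (w : gword X) : G :=
  \prod_(a <- w) (if a.2 then (g a.1)^-1 else g a.1).

Lemma gword_val_free_cong w1 w2 :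
  free_cong w1 w2 -> gword_val w1 = gword_val w2.
Proof.
elim=> {w1 w2} // [w1 w2 w3 _ -> _ -> //|u [x b] v].
rewrite /gword_val !big_cat !big_cons /=; congr (_ * _).
by case: b; rewrite ?mulKg ?mulVKg.
Qed.

Definition free_lift (x : free_group X) : G := gword_val (repr x).

Lemma free_lift_pi w : free_lift (\pi_(free_group X)%qT w) = gword_val w.
Proof. by apply/gword_val_free_cong/free_piP; rewrite reprK. Qed.

Lemma free_liftM : {morph free_lift : x y / x * y}.
Proof. by move=> x y; rewrite [LHS]free_lift_pi /gword_val big_cat. Qed.

Lemma free_lift1 : free_lift 1 = 1.
Proof. by rewrite [LHS]free_lift_pi /gword_val big_nil. Qed.

HB.instance Definition _ :=
  isUMagmaMorphism.Build (free_group X) G free_lift (free_lift1, free_liftM).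

Lemma free_lift_gen x : free_lift (free_gen x) = g x.
Proof. by rewrite free_lift_pi /gword_val big_seq1. Qed.

End FreeGroupLift.

Lemma free_group_ind (X : choiceType) (P : free_group X -> Prop) :
    P 1 -> (forall x y, P x -> P y -> P (x * y)) ->
    (forall x, P x -> P x^-1) -> (forall x, P (free_gen x)) ->
  forall x, P x.
Proof.
move=> P1 PM PV Pg x; elim/quotW: x.
elim=> [|[x b] w IHw]; first exact: P1.
rewrite -cat1s -free_mul_pi; apply: PM => //.
case: b; last exact: Pg.
have -> : \pi_(free_group X)%qT [:: (x, true)] = (free_gen x)^-1.
  by rewrite [RHS]free_inv_pi.
exact/PV/Pg.
Qed.

Section Presented.
Variables (X : choiceType) (R : free_group X -> free_group X -> Prop).

Definition pres_pi (x : free_group X) : presented R := \pi_(rel_quot R)%qT x.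

Lemma pres_piM : {morph pres_pi : x y / x * y}.
Proof. by move=> x y; rewrite [RHS]quot_mul_pi. Qed.

HB.instance Definition _ := isUMagmaMorphism.Build
  (free_group X) (presented R) pres_pi (erefl _, pres_piM).

Lemma pres_pi_rel x y : R x y -> pres_pi x = pres_pi y.
Proof. by move=> Rxy; apply/rel_piP/cong_rel. Qed.

(** Von Dyck's theorem: equality of images under [free_lift g] is a congruence containing [R], hence
    contains [rel_cong R]. *)
Lemma presented_lift (G : groupType) (g : X -> G) :
    (forall x y, R x y -> free_lift g x = free_lift g y) ->
  exists f : UMagmaMorphism.type (presented R) G,
    forall x, f (pres_gen R x) = g x.
Proof.
move=> Rg.
have cong_eq x y : rel_cong R x y -> free_lift g x = free_lift g y.
  elim=> {x y} // [x y z _ -> _ -> //|x x' y y' _ hx _ hy].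
  by rewrite !gmulfM /= hx hy.
pose f (x : presented R) : G := free_lift g (repr (x : rel_quot R)).
have f_pi x : f (pres_pi x) = free_lift g x.
  by apply/cong_eq/rel_piP; rewrite reprK.
have fM : {morph f : x y / x * y}.
  by move=> x y; rewrite [LHS]f_pi gmulfM.
have f1 : f 1 = 1 by rewrite [LHS]f_pi gmulf1.
pose f_mor := isUMagmaMorphism.Build (presented R) G f (f1, fM).
pose F : UMagmaMorphism.type (presented R) G := HB.pack f f_mor.
by exists F => x; rewrite /= [LHS]f_pi free_lift_gen.
Qed.

Lemma presented_ext (G : groupType)
    (f1 f2 : UMagmaMorphism.type (presented R) G) :
  (forall x, f1 (pres_gen R x) = f2 (pres_gen R x)) -> f1 =1 f2.
Proof.
move=> f12 x; elim/quotW: x => x; rewrite -/(pres_pi x).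
elim/free_group_ind: x => [|x y hx hy|x hx|//].
- by rewrite !gmulf1.
- by rewrite !gmulfM /= hx hy.
- by rewrite !gmulfV hx.
Qed.

End Presented.

(** * Transport of indexed families and relations along morphisms *)

(** Morphisms preserve the default value 1, so no range condition on [x] arises. *)
Lemma ext_map (T : Type) (P : pred T) (G H : groupType)
    (f : UMagmaMorphism.type G H) (g : {x | P x} -> G) x :
  f (ext g x) = ext (f \o g) x.
Proof. by rewrite /ext; case: insubP => //= _; exact: gmulf1. Qed.

Lemma ext_val (T : Type) (P : pred T) (G : groupType) (g : {x | P x} -> G) u :
  ext g (val u) = g u.
Proof. by rewrite /ext valK. Qed.

Lemma eq_ext (T : Type) (P : pred T) (G : groupType) (g h : {x | P x} -> G) :
  g =1 h -> ext g =1 ext h.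
Proof. by move=> gh x; rewrite /ext; case: insub. Qed.

Section RelationMorphisms.
Variables (G H : groupType) (f : UMagmaMorphism.type G H) (n : nat).

Lemma artin_rel_map (s : nat -> G) (s' : nat -> H) x y :
    (forall i, f (s i) = s' i) ->
  artin_rel n s x y -> artin_rel n s' (f x) (f y).
Proof. by move=> fs; case=> *; rewrite !gmulfM !fs; constructor. Qed.

Lemma redundant_rel_map (s : nat -> G) (A : nat -> nat -> G)
    (s' : nat -> H) (A' : nat -> nat -> H) x y :
    (forall i, f (s i) = s' i) -> (forall i j, f (A i j) = A' i j) ->
  redundant_rel n s A x y -> redundant_rel n s' A' (f x) (f y).
Proof.
move=> fs fA; case=> [{}x {}y /(artin_rel_map fs)|*|*|*|*|*|*|*|*|*|*|*];
  rewrite ?(gmulfM, gmulfV, gmulfXn) /= ?(gmulfV, fs, fA); by constructor.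
Qed.

(** Applied to the projection of a free group onto a presented group, it turns imposed relations
    into equalities. *)
Lemma artin_rel_eq_map (s : nat -> G) (s' : nat -> H) :
    (forall i, f (s i) = s' i) ->
    (forall x y, artin_rel n s x y -> f x = f y) ->
  forall x y, artin_rel n s' x y -> x = y.
Proof.
by move=> fs fR x y; case=> *; rewrite -!fs -!gmulfM; apply: fR; constructor.
Qed.

End RelationMorphisms.

(** This makes the $A_{ij}$ redundant: $\Sigma_3$ and $M_1$ already define them from the
    $\sigma_i$. *)
Lemma pure_family_unique (G : groupType) (n : nat) (s : nat -> G)
    (A A' : nat -> nat -> G) :
    (forall i, 0 < i < n -> A i i.+1 = s i ^+ 2) ->
    (forall i j, 0 < i -> i.+1 < j <= n -> A i j = A i.+1 j ^ s i) ->
    (forall i, 0 < i < n -> A' i i.+1 = s i ^+ 2) ->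
    (forall i j, 0 < i -> i.+1 < j <= n -> A' i j = A' i.+1 j ^ s i) ->
  forall i j, 0 < i < j -> j <= n -> A i j = A' i j.
Proof.
move=> Ab As A'b A's i [|j] hij hj; first lia.
have {}hij : 0 < i <= j by lia.
have j_gt0 : 0 < j by lia.
move: i hij; apply: nat_down_ind => [|i hi IHi].
  by rewrite Ab ?A'b //; lia.
by rewrite As ?(A's i) ?IHi //; lia.
Qed.

(** * The Artin relations and the elements $A_{ij}$ in the braid group *)

Section BraidGroup.
Variable n : nat.
Local Notation s := (ext (@sigma n)).
Local Notation A :=
  (fun i j => ext (fun p : pure_index n => pure_gen n (val p).1 (val p).2) (i, j)).

Lemma braid_group_artin x y : artin_rel n s x y -> x = y.
Proof.
apply: (@artin_rel_eq_map _ _ (@pres_pi _ (@braid_rel n)) n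
  (ext (@free_gen (sigma_index n)))); last exact: pres_pi_rel.
by move=> i; rewrite ext_map.
Qed.

Lemma pure_gen_ext i j : 0 < i < j -> j <= n -> A i j = pure_gen n i j.
Proof.
move=> hij hj; have hp : (0 < (i, j).1 < (i, j).2) && ((i, j).2 <= n).
  by rewrite hij.
exact: (ext_val _ (exist _ (i, j) hp : pure_index n)).
Qed.

Lemma pure_gen_base i : pure_gen n i i.+1 = s i ^+ 2.
Proof. by rewrite /pure_gen /= /index_iota subnn !big_nil mul1g mulg1. Qed.

(** The outermost letters $\sigma_i^{-1}$ and $\sigma_i$ of the defining word split off. *)
Lemma pure_gen_step i j : i.+1 < j -> pure_gen n i j = pure_gen n i.+1 j ^ s i.
Proof.
move=> hij; have hi : i < j.-1 by lia.
rewrite /pure_gen big_ltn // {2}/index_iota -(subnSK hi) /= rev_cons -cats1.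
by rewrite big_cat big_seq1 conjgE !mulgA.
Qed.

End BraidGroup.

(** * Mutually inverse morphisms between the two presented groups *)

Theorem proposition2p4 (n : nat) (n_ge1 : (1 <= n)%N) :
  has_presentation (braid_group n) (@redundant_braid_rel n) (@redundant_gen_val n).
Proof.
pose Q := presented (@redundant_braid_rel n).
pose gQ : redundant_gen n -> Q := pres_gen (@redundant_braid_rel n).
pose sQ := ext (fun i : sigma_index n => gQ (inl i)).
pose AQ i j := ext (fun p : pure_index n => gQ (inr p)) (i, j).
pose sB := ext (@sigma n).
pose AB i j :=
  ext (fun p : pure_index n => pure_gen n (val p).1 (val p).2) (i, j).
have AB_base i : 0 < i < n -> AB i i.+1 = sB i ^+ 2.
  by move=> hi; rewrite /AB pure_gen_ext ?pure_gen_base //; lia.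
have AB_step i j : 0 < i -> i.+1 < j <= n -> AB i j = AB i.+1 j ^ sB i.
  by move=> hi hj; rewrite /AB (@pure_gen_ext n i j) ?(@pure_gen_ext n i.+1 j)
      ?(@pure_gen_step n i j) //; lia.
(* [F] exists because every redundant relation holds in the braid group. *)
have [F FE] : exists f : UMagmaMorphism.type Q (braid_group n),
    forall x, f (gQ x) = redundant_gen_val x.
  apply: presented_lift => x y Rxy.
  apply: (redundant_rel_eq (@braid_group_artin n) AB_base AB_step).
  apply: redundant_rel_map Rxy => [i|i j]; rewrite ext_map;
    by apply: eq_ext => u; rewrite /= free_lift_gen.
pose proj : UMagmaMorphism.type (free_group (redundant_gen n)) Q :=
  pres_pi (@redundant_braid_rel n).
have sQ_proj i : proj (ext (fun i => free_gen (inl i)) i) = sQ i.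
  exact: ext_map.
have AQ_proj i j : proj (ext (fun p => free_gen (inr p)) (i, j)) = AQ i j.
  exact: ext_map.
have sQ_artin x y : artin_rel n sQ x y -> x = y.
  apply: (artin_rel_eq_map sQ_proj) => {}x {}y Rxy.
  by apply: pres_pi_rel; exact: Sigma12.
have AQ_base i : 0 < i < n -> AQ i i.+1 = sQ i ^+ 2.
  move=> hi; rewrite -AQ_proj -sQ_proj -gmulfXn; apply/esym/pres_pi_rel.
  exact: Sigma3.
have AQ_step i j : 0 < i -> i.+1 < j <= n -> AQ i j = AQ i.+1 j ^ sQ i.
  move=> hi hj; rewrite -!AQ_proj -sQ_proj -gmulfJ conjgE mulgA.
  (* $M_1$ is taken at i + 1, so that its [s i.-1] becomes [s i]. *)
  by apply/esym/pres_pi_rel; apply: (@M1 _ _ _ _ i.+1); lia.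
(* For the inverse [H], only the Artin relations have to hold in [Q]. *)
have [H HE] : exists f : UMagmaMorphism.type (braid_group n) Q,
    forall i, f (sigma i) = gQ (inl i).
  apply: presented_lift => x y Rxy; apply: sQ_artin.
  apply: artin_rel_map Rxy => i; rewrite ext_map.
  by apply: eq_ext => u; rewrite /= free_lift_gen.
have HA i j : 0 < i < j -> j <= n -> H (AB i j) = AQ i j.
  have Hs k : H (sB k) = sQ k by rewrite ext_map; exact: eq_ext.
  apply: (@pure_family_unique _ _ sQ (fun i j => H (AB i j))) => //.
    by move=> k hk; rewrite AB_base // gmulfXn Hs.
  by move=> k l hk hl; rewrite AB_step // gmulfJ Hs.
exists F; split; last exact: FE.
exists H.
  (* On the generators $\sigma_i$ this is the choice of [H]; on the $A_{ij}$ it is [HA]. *)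
  apply: (@presented_ext _ _ _ (H \o F) idfun) => -[i|p] /=; rewrite FE //=.
  have /andP[hp1 hp2] := valP p.
  have := HA _ _ hp1 hp2; rewrite /AB /AQ -surjective_pairing.
  by rewrite !ext_val.
apply: (@presented_ext _ _ _ (F \o H) idfun) => i /=.
by rewrite HE FE.
Qed.
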